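(* Let $\mu$ be a partition, let $\sigma$ be a filling of the Young diagram of $\mu$, and let $[\sigma]$ denote the row-equivalency class of $\sigma$. Then $$\sum_{\tau\in [\sigma]}t^{\mathrm{maj}(\tau)}q^{\mathrm{inv}(\tau)}=\sum_{\tau\in [\sigma]}t^{\mathrm{maj}(\tau)}q^{\mathrm{quinv}(\tau)}.$$ If $\sigma$ is a rectangular filling (that is, $\mu=(n^m)$ has exactly $m$ parts, all equal to $n$, for some $m,n\ge 1$), then $$\sum_{\tau\in [\sigma]}t^{\mathrm{maj}(\tau)}q^{\mathrm{inv}(\tau)}u^{\mathrm{quinv}(\tau)}=\sum_{\tau\in [\sigma]}t^{\mathrm{maj}(\tau)}u^{\mathrm{inv}(\tau)}q^{\mathrm{quinv}(\tau)}.$$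
   Context: A partition $\mu=(\mu_1\ge\cdots\ge\mu_k)$ is a weakly decreasing sequence of positive integers; $\mu'$ is its transpose, so $\mu'_j$ is the height of column $j$. The Young diagram of $\mu$ is drawn in French convention: it consists of boxes $(r,j)$, $1\le r\le k$, $1\le j\le \mu_r$, with rows $r$ numbered from bottom to top and columns $j$ from left to right. A filling of the Young diagram is a function $\sigma:\mu\to\mathbb{P}$ assigning a positive integer $\sigma(z)$ to each box $z$; $\mathcal{T}(\mu)$ is the set of fillings. Two fillings $\sigma,\tau\in\mathcal{T}(\mu)$ are row-equivalent, $\sigma\sim\tau$, if for every $i$ the multisets of entries in the $i$th rows of $\sigma$ and $\tau$ are identical; $[\sigma]=\{\tau\in\mathcal{T}(\mu):\tau\sim\sigma\}$. Major index: $\mathrm{South}(z)$ is the box immediately below $z$. The descent set $\mathrm{Des}(\sigma)$ is the set of boxes $z\in\mu$ not in the bottom row with $\sigma(z)>\sigma(\mathrm{South}(z))$; $\mathrm{leg}(z)$ is the number of boxes of $\mu$ strictly above $z$ in its column; $\mathrm{maj}(\sigma)=\sum_{z\in \mathrm{Des}(\sigma)}(\mathrm{leg}(z)+1)$. Boundary convention: extend $\sigma$ by $\sigma(\mu'_j+1,j)=0$ and $\sigma(0,j)=\infty$ for $1\le j\le \mu_1$ (an extra box with entry $0$ above the top box of each column and an extra box with entry $\infty$ below the bottom box of each column). For $a,b,c\in\{0,1,2,\dots\}\cup\{\infty\}$ put $Q(a,b,c)=1$ if $a<b<c$, or $b<c<a$, or $c<a<b$, or $a=b\neq c$; otherwise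 $Q(a,b,c)=0$. A queue inversion triple of $\sigma$ is a triple of entries (in specified boxes, extra boxes allowed) $a=\sigma(r+1,i)$, $b=\sigma(r,i)$, $c=\sigma(r,j)$ with $i<j$, $c\ne 0$ and $Q(a,b,c)=1$. An inversion triple of $\sigma$ is a triple of entries $a=\sigma(r,i)$, $b=\sigma(r-1,i)$, $c=\sigma(r,j)$ with $i<j$, $c\neq 0$ and $Q(a,b,c)=1$. $\mathrm{quinv}(\sigma)$ and $\mathrm{inv}(\sigma)$ are the numbers of queue inversion triples and inversion triples of $\sigma$, respectively (counted by positions). *)

(* Defs.v *)
From HB Require Import structures.
From mathcomp Require Import all_boot all_order all_algebra.
From mathcomp Require Import mpoly.

Set Implicit Arguments.
Unset Strict Implicit.
Unset Printing Implicit Defensive.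

Import GRing.Theory.
Local Open Scope nat_scope.

(* Rows and columns are numbered from 1, the bottom row being row 1, so that
   row 0 is available for the extra boxes below the diagram.  A filling is the
   sequence of its rows, from bottom to top, each read from left to right. *)

Definition is_partition (mu : seq nat) : bool :=
  sorted geq mu && all (leq 1) mu.

Definition in_diagram (mu : seq nat) (r j : nat) : bool :=
  [&& 1 <= r, r <= size mu, 1 <= j & j <= nth 0 mu r.-1].

(* mu'_j, the j-th part of the transpose *)
Definition col_height (mu : seq nat) (j : nat) : nat := count (leq j) mu.

Definition is_filling (mu : seq nat) (sigma : seq (seq nat)) : bool :=
  (shape sigma == mu) && all (all (leq 1)) sigma.

Definition entry (sigma : seq (seq nat)) (r j : nat) : nat :=
  nth 0 (nth [::] sigma r.-1) j.-1.

(* For fillings of the same shape. *)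
Definition row_equiv (sigma tau : seq (seq nat)) : bool :=
  all2 (fun s t => perm_eq s t) sigma tau.

(* The class of sigma, enumerated without repetition: every row is replaced
   by each of its distinct rearrangements; see mem_row_class, row_class_uniq. *)
Fixpoint row_class (sigma : seq (seq nat)) : seq (seq (seq nat)) :=
  if sigma is s :: sigma' then
    [seq t :: tau | t <- permutations s, tau <- row_class sigma']
  else [:: [::]].

Lemma row_class_uniq (sigma : seq (seq nat)) : uniq (row_class sigma).
Proof.
elim: sigma => //= s sigma IH.
apply: allpairs_uniq => //; first exact: permutations_uniq.
by case=> t tau [t' tau'] _ _ /= [-> ->].
Qed.

Lemma mem_row_class (mu : seq nat) (sigma tau : seq (seq nat)) :
  is_filling mu sigma ->
  (tau \in row_class sigma) = is_filling mu tau && row_equiv sigma tau.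
Proof.
elim: sigma mu tau => [|s sigma IH] [|m mu] [|t tau] //=;
  rewrite /is_filling //=.
- by move=> _; apply/allpairsP => -[[x y] [_ _]].
rewrite !eqseq_cons => /andP[/andP[/eqP sz shp] /andP[pos_s pos_sg]].
have {}IH := IH mu tau; rewrite /is_filling shp pos_sg in IH.
have -> : (t :: tau \in [seq x :: y | x <- permutations s, y <- row_class sigma])
          = perm_eq s t && (tau \in row_class sigma).
  rewrite perm_sym -mem_permutations; apply/allpairsP/andP.
    by case=> -[x y] /= [xs yc [-> ->]].
  by case=> ts tc; exists (t, tau).
rewrite IH //; case st: (perm_eq s t); last by rewrite /= andbF.
by rewrite -(perm_size st) sz eqxx -(perm_all _ st) pos_s.
Qed.

Definition leg (mu : seq nat) (r j : nat) : nat :=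
  \sum_(r.+1 <= r' < (size mu).+1 | in_diagram mu r' j) 1.

Definition is_descent (mu : seq nat) (sigma : seq (seq nat)) (r j : nat) :=
  [&& in_diagram mu r j, r != 1 & entry sigma r j > entry sigma r.-1 j].

Definition filling_maj (mu : seq nat) (sigma : seq (seq nat)) : nat :=
  \sum_(1 <= r < (size mu).+1)
    \sum_(1 <= j < (head 0 mu).+1 | is_descent mu sigma r j) (leg mu r j + 1).

(* The extended entries {0, 1, 2, ...} with infinity are encoded by option nat,
   None being infinity. *)
Definition ltx (a b : option nat) : bool :=
  match a, b with
  | Some x, Some y => x < y
  | Some _, None => true
  | None, _ => false
  end.

Definition Q (a b c : option nat) : bool :=
  [|| ltx a b && ltx b c, ltx b c && ltx c a, ltx c a && ltx a b
    | (a == b) && (b != c)].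

(* The diagram with one extra box below and one above each column. *)
Definition in_ext_diagram (mu : seq nat) (r j : nat) : bool :=
  [&& 1 <= j, j <= head 0 mu & r <= (col_height mu j).+1].

Definition ext_entry (mu : seq nat) (sigma : seq (seq nat)) (r j : nat) :
    option nat :=
  if r == 0 then None
  else if r == (col_height mu j).+1 then Some 0
  else Some (entry sigma r j).

Definition quinv_triple (mu : seq nat) (sigma : seq (seq nat)) (r i j : nat) :=
  [&& in_ext_diagram mu r.+1 i, in_ext_diagram mu r i, in_ext_diagram mu r j,
      i < j, ext_entry mu sigma r j != Some 0
    & Q (ext_entry mu sigma r.+1 i) (ext_entry mu sigma r i)
        (ext_entry mu sigma r j)].

Definition inv_triple (mu : seq nat) (sigma : seq (seq nat)) (r i j : nat) :=
  [&& 1 <= r, in_ext_diagram mu r i, in_ext_diagram mu r.-1 i,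
      in_ext_diagram mu r j, i < j, ext_entry mu sigma r j != Some 0
    & Q (ext_entry mu sigma r i) (ext_entry mu sigma r.-1 i)
        (ext_entry mu sigma r j)].

(* The ranges below cover the whole extended diagram: 0 <= r <= size mu + 1
   and 1 <= i, j <= mu_1. *)
Definition filling_quinv (mu : seq nat) (sigma : seq (seq nat)) : nat :=
  \sum_(0 <= r < (size mu).+2) \sum_(1 <= i < (head 0 mu).+1)
    \sum_(1 <= j < (head 0 mu).+1 | quinv_triple mu sigma r i j) 1.

Definition filling_inv (mu : seq nat) (sigma : seq (seq nat)) : nat :=
  \sum_(0 <= r < (size mu).+2) \sum_(1 <= i < (head 0 mu).+1)
    \sum_(1 <= j < (head 0 mu).+1 | inv_triple mu sigma r i j) 1.

(* The indeterminates t, q, u of the polynomial ring Z[t, q, u]. *)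
Definition tvar : {mpoly int[3]} := 'X_(@Ordinal 3 0 isT).
Definition qvar : {mpoly int[3]} := 'X_(@Ordinal 3 1 isT).
Definition uvar : {mpoly int[3]} := 'X_(@Ordinal 3 2 isT).

(* Main.v *)
Require Import Defs.
From HB Require Import structures.
From mathcomp Require Import all_boot all_order all_algebra.
From mathcomp Require Import mpoly.
From mathcomp Require Import zify.

Set Implicit Arguments.
Unset Strict Implicit.
Unset Printing Implicit Defensive.

(* A filling is treated as the list of its columns; inv and quinv are then sums
   over pairs of columns.  For two adjacent columns x, y with x at least as tall
   as y, call two consecutive rows crossed when exchanging the two entries of one
   of these rows changes the number of descents between them.  Maximal runs of
   crossed rows form blocks.  Inside a block, inversion triples and queue
   inversion triples are equally many and insensitive to exchanging the two
   columns within the block.  Such an exchange toggles the inversion triple at the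
   bottom row of the block and the queue inversion triple at its top row.
   Exchanging exactly the blocks where one of these two triples is present and the
   other is not is an involution (exch) that swaps inv and quinv of the pair and
   keeps maj and all contributions involving a third column.

   Moving short columns to the left of tall ones by such exchanges turns the inv
   of each pair of unequal heights into a quinv of the mirror image.  Reversing
   next each group of columns of equal height keeps the part of inv that is
   linear in the cells and permutes the descent numbers of the columns, which
   turns inv into mirrored quinv inside the group.  Mirroring the result yields a
   bijection of the row class with the original shape; on a rectangle it carries
   quinv to inv as well. *)

(** * Exchanging two columns *)

Definition cyc (a b c : nat) : bool := Q (Some a) (Some b) (Some c).

Ltac case_lt :=
  repeat match goal with |- context [leq (S ?a) ?b] =>
    case: (ltnP a b) => ?; try (exfalso; lia) end.

(** The number [(b < c) + (c < a) - (b < a)] is always 0 or 1, since [<] is transitive and [b < a]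
    forces [b < c] or [c < a]; it is the indicator of [Q], ties included. This turns all statements
    on triples into linear arithmetic. *)
Lemma cycE a b c : cyc a b c = ((b < c) + (c < a) == (b < a).+1).
Proof.
rewrite /cyc /Q /= !(inj_eq Some_inj).
have [ab|ab|->] := ltngtP a b; have [bc|bc|?] := ltngtP b c; case: (ltngtP c a) => ?;
  subst => //=; lia.
Qed.

Lemma cyc_add a b c : cyc a b c + (b < a) = (b < c) + (c < a).
Proof. by rewrite cycE; case_lt. Qed.

Lemma cyc_refl_r a b : cyc a b b = false.
Proof. by rewrite cycE; case_lt. Qed.

Lemma cyc_refl_l a b : cyc a b a = false.
Proof. by rewrite cycE; case_lt. Qed.

Lemma cyc_swap_r a b c : b != c -> cyc a c b = ~~ cyc a b c.
Proof. by rewrite neq_ltn !cycE; case_lt. Qed.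

Lemma cyc_swap_l a b c : a != c -> cyc c b a = ~~ cyc a b c.
Proof. by rewrite neq_ltn !cycE; case_lt. Qed.

(** * Crossed pairs of rows *)

Definition cross (x y x' y' : nat) : bool :=
  (x < x') + (y < y') != (x < y') + (y < x').

Lemma crossC x y x' y' : cross y x x' y' = cross x y x' y'.
Proof. by rewrite /cross eq_sym; congr (_ != _); rewrite addnC. Qed.

Lemma crossCr x y x' y' : cross x y y' x' = cross x y x' y'.
Proof. by rewrite /cross eq_sym. Qed.

Lemma cross_refl x x' y' : cross x x x' y' = false.
Proof. by rewrite /cross addnC eqxx. Qed.

(** Here [x'], [y'] lie above [x], [y]. Crossing means that exactly one of [x'], [y'] lies above the
    smaller of [x], [y] without exceeding the larger, so the pairs interlace cyclically. Hence the
    queue triple of the lower row agrees with the inversion triple of the upper one, and exchanging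
    both rows changes neither. *)
Lemma cross_cyc x y x' y' : cross x y x' y' ->
  [/\ cyc x' x y = cyc x' x y', cyc y' y x = cyc x' x y' & cyc y' y x' = cyc x' x y'].
Proof. rewrite /cross !cycE; by case_lt. Qed.

(** By [cycE] the two triples differ by [(x < x') + (y < y') - (x < y') - (y < x')], which is 0 for
    uncrossed rows. So at a block boundary the inversion triple of the upper row ignores exchanges
    below, and by the next lemma the queue triple of the lower row ignores exchanges above. *)
Lemma uncross_cycl x y x' y' : ~~ cross x y x' y' -> cyc x' y y' = cyc x' x y'.
Proof. by rewrite /cross !cycE; case_lt. Qed.

Lemma uncross_cycr x y x' y' : ~~ cross x y x' y' -> cyc y' x y = cyc x' x y.
Proof. by rewrite /cross !cycE; case_lt. Qed.

(* The queue inversion triple at the top row of the lowest block.  Columns are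
   listed from the bottom, and [head 0] supplies the extra entry 0 above them. *)
Fixpoint top_quinv (x y : seq nat) : bool :=
  match x, y with
  | u :: x', v :: y' =>
    if y' is v' :: _ then
      if cross u v (head 0 x') v' then top_quinv x' y' else cyc (head 0 x') u v
    else cyc (head 0 x') u v
  | _, _ => false
  end.

(** Crossed rows share the decision [b]. At a boundary, [cyc (head 0 x) u v'] is the bottom
    inversion triple of the next block. *)
Definition next_swap (b : bool) (u v : nat) (x y : seq nat) : bool :=
  if y is v' :: _ then
    if cross u v (head 0 x) v' then b
    else cyc (head 0 x) u v' != top_quinv x y
  else b.

(* [b] tells whether the lowest block is exchanged. *)
Fixpoint swaps (b : bool) (x y : seq nat) : seq nat * seq nat :=
  match x, y with
  | u :: x', v :: y' =>
    let p := swaps (next_swap b u v x' y') x' y' in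
    if b then (v :: p.1, u :: p.2) else (u :: p.1, v :: p.2)
  | _, _ => (x, y)
  end.

(** [b] is the entry just below the left column. Stopping where the right column ends encodes the
    condition that the third entry is nonzero. *)
Fixpoint inv_over (b : option nat) (x y : seq nat) : nat :=
  match x, y with
  | u :: x', v :: y' => Q (Some u) b (Some v) + inv_over (Some u) x' y'
  | _, _ => 0
  end.

Definition inv2 : seq nat -> seq nat -> nat := inv_over None.

Fixpoint quinv2 (x y : seq nat) : nat :=
  match x, y with
  | u :: x', v :: y' => cyc (head 0 x') u v + quinv2 x' y'
  | _, _ => 0
  end.

Lemma swaps_cons b u x v y :
  swaps b (u :: x) (v :: y) =
  ((if b then v else u) :: (swaps (next_swap b u v x y) x y).1,
   (if b then u else v) :: (swaps (next_swap b u v x y) x y).2).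
Proof. by case: b. Qed.

Lemma swaps_nil b x : swaps b x [::] = (x, [::]).
Proof. by case: x. Qed.

Lemma size_swaps b x y :
  (size (swaps b x y).1 = size x) * (size (swaps b x y).2 = size y).
Proof.
elim: x y b => [|u x IH] [|v y] b //; rewrite swaps_cons /=.
by rewrite !IH.
Qed.

Lemma top_quinv_refl u x y : top_quinv (u :: x) (u :: y) = false.
Proof. by case: y => [|v y] /=; rewrite ?cross_refl cyc_refl_r. Qed.

Lemma cyc_if b a u v : 
  cyc a (if b then v else u) (if b then u else v) = (b && (u != v)) (+) cyc a u v.
Proof.
case: b => //=; have [->|uv] := eqVneq; first by rewrite cyc_refl_r.
by rewrite (cyc_swap_r _ uv).
Qed.

Lemma cyc_ifl b u x y :
  cyc (if b then y else x) u (if b then x else y) = (b && (x != y)) (+) cyc x u y.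
Proof.
case: b => //=; have [->|uv] := eqVneq; first by rewrite cyc_refl_l.
by rewrite (cyc_swap_l _ uv).
Qed.

Lemma cross_if b b' u v x y :
  cross (if b then v else u) (if b then u else v)
        (if b' then y else x) (if b' then x else y) = cross u v x y.
Proof. by case: b; case: b' => //; rewrite ?(crossC u v) ?(crossCr _ _ x y). Qed.

Lemma uncross_cycl_if b u v x y : ~~ cross u v x y ->
  cyc x (if b then v else u) y = cyc x u y.
Proof. by move=> nc; case: b => //; apply: uncross_cycl. Qed.

Lemma uncross_cycr_if b u v x y : ~~ cross u v x y ->
  cyc (if b then y else x) u v = cyc x u v.
Proof. by move=> nc; case: b => //; apply: uncross_cycr. Qed.

Lemma cross_neq u v x y : cross u v x y -> (u != v) && (x != y).
Proof.
move=> cr; apply/andP; split; apply: contraTneq cr => ->.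
  by rewrite cross_refl.
by rewrite /cross eqxx.
Qed.

(** Exchanging the top row of a block toggles its queue triple, and the entry above, belonging to an
    uncrossed row, does not matter. Entries of crossed rows are distinct, so the condition [u != v]
    propagates up to the top of the block. *)
Lemma top_quinv_swaps b u x v y : size y <= size x ->
  top_quinv (swaps b (u :: x) (v :: y)).1 (swaps b (u :: x) (v :: y)).2
  = (b && (u != v)) (+) top_quinv (u :: x) (v :: y).
Proof.
elim: x u v y b => [|u' x IH] u v [|v' y] b //.
- by move=> _; rewrite swaps_cons swaps_nil /= cyc_if.
- by move=> _; rewrite swaps_cons swaps_nil /= cyc_if.
rewrite [size _ <= _]ltnS => syx.
rewrite swaps_cons swaps_cons /= -/(swaps _ _ _) cross_if.
case: ifP => cr.
  have := IH u' v' y (next_swap b u v (u' :: x) (v' :: y)) syx.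
  rewrite swaps_cons /= cr => ->; case/andP: (cross_neq cr) => -> ->.
  by [].
by rewrite cyc_if uncross_cycr_if ?cr.
Qed.

Lemma quinv2_cons u x v y :
  quinv2 (u :: x) (v :: y) = cyc (head 0 x) u v + quinv2 x y.
Proof. by []. Qed.

Lemma inv_over_cons a u x v y :
  inv_over (Some a) (u :: x) (v :: y) = cyc u a v + inv_over (Some u) x y.
Proof. by []. Qed.

Lemma top_quinv_cons u x v v' y :
  top_quinv (u :: x) (v :: v' :: y) =
  if cross u v (head 0 x) v' then top_quinv x (v' :: y) else cyc (head 0 x) u v.
Proof. by []. Qed.

Lemma inv_over_nil b x : inv_over b x [::] = 0.
Proof. by case: x. Qed.

(** A block is exchanged when its two deciding triples differ, and toggling the bottom inversion
    triple then makes it equal to the old top queue triple. Equal bottom entries leave both triples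
    absent. *)
Lemma next_swap_uncross b u v x y v' : ~~ cross u v (head 0 x) v' ->
  (next_swap b u v x (v' :: y) && (head 0 x != v')) (+) cyc (head 0 x) u v'
  = top_quinv x (v' :: y).
Proof.
rewrite /next_swap => /negbTE ->; have [e|_] := eqVneq (head 0 x) v'; last first.
  by rewrite andbT; case: (cyc _ _ _); case: (top_quinv _ _).
rewrite andbF e cyc_refl_l; case: x e => [|u' x] // <-.
by rewrite top_quinv_refl.
Qed.

(** Inside a block the inversion triple of a row matches the queue triple of the row below; at a
    boundary the new inversion triple is the old top queue triple of the block above. Only the top
    queue triple of the lowest block stays unmatched. *)
Lemma inv_over_swaps b u x v y (p := swaps (next_swap b u v x y) x y) :
  size y <= size x ->
  inv_over (Some (if b then v else u)) p.1 p.2 + top_quinv (u :: x) (v :: y)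
  = quinv2 (u :: x) (v :: y).
Proof.
rewrite {}/p.
elim: x u v y b => [|u' x IH] u v [|v' y] b //.
- by move=> _; rewrite swaps_nil inv_over_nil /= addn0.
- by move=> _; rewrite swaps_nil inv_over_nil /= addn0.
rewrite [size _ <= _]ltnS => syx.
have := IH u' v' y (next_swap b u v (u' :: x) (v' :: y)) syx.
have := @next_swap_uncross b u v (u' :: x) y v'; rewrite [head _ _]/=.
have : cross u v u' v' -> next_swap b u v (u' :: x) (v' :: y) = b by rewrite /= => ->.
move: (next_swap b u v (u' :: x) (v' :: y)) => nb cr nc E1.
rewrite swaps_cons top_quinv_cons quinv2_cons [head _ _]/= inv_over_cons -E1.
move: (inv_over _ _ _) => I /=.
case: (boolP (cross u v u' v')) cr nc => [cr /(_ isT) -> _|ncr _ /(_ isT) nc].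
  have [E2 _ E3] := cross_cyc cr.
  suff -> : cyc (if b then v' else u') (if b then v else u) (if b then u' else v') =
       cyc u' u v by rewrite addnA.
  by case: (b); rewrite ?E3 E2.
rewrite uncross_cycl_if; last by case: (nb); rewrite // crossCr.
by rewrite cyc_ifl nc addnC [X in _ + X]addnC.
Qed.

(** The same matching in the other direction: new top queue triples are old bottom inversion
    triples, except in the lowest block, where the toggled triple appears. *)
Lemma quinv2_swaps b u x v y : size y <= size x ->
  quinv2 (swaps b (u :: x) (v :: y)).1 (swaps b (u :: x) (v :: y)).2
  = inv_over (Some u) x y + ((b && (u != v)) (+) top_quinv (u :: x) (v :: y)).
Proof.
elim: x u v y b => [|u' x IH] u v [|v' y] b //.
- by move=> _; rewrite swaps_cons swaps_nil /= cyc_if addn0.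
- by move=> _; rewrite swaps_cons swaps_nil /= cyc_if addn0.
rewrite [size _ <= _]ltnS => syx; rewrite swaps_cons quinv2_cons top_quinv_cons inv_over_cons.
have := IH u' v' y (next_swap b u v (u' :: x) (v' :: y)) syx.
have := @next_swap_uncross b u v (u' :: x) y v'; rewrite [head _ _]/=.
have : cross u v u' v' -> next_swap b u v (u' :: x) (v' :: y) = b by rewrite /= => ->.
move: (next_swap b u v (u' :: x) (v' :: y)) => nb cr nc E1.
rewrite E1.
rewrite swaps_cons [head _ _]/=.
case: (boolP (cross u v u' v')) cr nc => [cr /(_ isT) -> _|ncr _ /(_ isT) nc].
  have [E2 E3 _] := cross_cyc cr; have [-> ->] := andP (cross_neq cr).
  suff -> : cyc (if b then v' else u') (if b then v else u) (if b then u else v) =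
       cyc u' u v' by rewrite addnA.
  by case: (b); rewrite ?E3 ?E2.
rewrite uncross_cycr_if; last by case: (b); rewrite // crossC.
by rewrite cyc_if -nc addbA addbb addFb addnC [inv_over _ _ _ + _]addnC.
Qed.

(* Descents within the lowest [k] rows; for [size c < k] the padding by 0 above
   the column creates none. *)
Definition desc (k : nat) (c : seq nat) : nat :=
  \sum_(r < k.-1) (nth 0 c r < nth 0 c r.+1).

Lemma desc1 k c : k <= 1 -> desc k c = 0.
Proof. by case: k => [|[|k]] // _; rewrite /desc big_ord0. Qed.

Lemma desc_cons k u c : desc k.+2 (u :: c) = (u < head 0 c) + desc k.+1 c.
Proof. by rewrite /desc /= big_ord_recl /= nth0. Qed.

Lemma descS k c : desc k.+2 c = desc k.+1 c + (nth 0 c k < nth 0 c k.+1).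
Proof. by rewrite /desc big_ord_recr. Qed.

Lemma next_swap_cross b u v x v' y :
  cross u v (head 0 x) v' -> next_swap b u v x (v' :: y) = b.
Proof. by rewrite /next_swap => ->. Qed.

Lemma asc_if b b' u v x y : (cross u v x y -> b' = b) ->
  ((if b then v else u) < (if b' then y else x)) +
  ((if b then u else v) < (if b' then x else y)) = (u < x) + (v < y).
Proof.
rewrite /cross; have [E _|_ /(_ isT) ->] := eqVneq ((u < x) + (v < y)) _.
  by case: (b); case: (b'); lia.
by case: b; rewrite // addnC.
Qed.

(** Crossed consecutive rows are exchanged together; between uncrossed ones the number of descents
    does not depend on exchanges. *)
Lemma desc_swaps b x y k : size y <= size x -> k <= size y ->
  desc k (swaps b x y).1 + desc k (swaps b x y).2 = desc k x + desc k y.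
Proof.
elim: x y b k => [|u x IH] [|v y] b // [|[|k]] //; try by rewrite !desc1.
case: x y IH => [|u' x] [|v' y] // IH syx sky.
have E := IH (v' :: y) (next_swap b u v (u' :: x) (v' :: y)) k.+1 syx sky.
have C := @next_swap_cross b u v (u' :: x) v' y.
rewrite swaps_cons !desc_cons addnACA E [RHS]addnACA.
by rewrite swaps_cons [head _ _]/= [head _ _]/= asc_if.
Qed.

(* Symmetric in the two entries of each row, hence unchanged by exchanges. *)
Fixpoint lt_neq_count (x y : seq nat) : nat :=
  match x, y with
  | u :: x', v :: y' =>
    (u != v) + (u < head 0 x') + (v < head 0 x')
    + (if y' is v' :: _ then (u < v') + (v < v') else 0) + lt_neq_count x' y'
  | _, _ => 0
  end.

Lemma lt_neq_count_swaps b x y : size y <= size x ->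
  lt_neq_count (swaps b x y).1 (swaps b x y).2 = lt_neq_count x y.
Proof.
elim: x y b => [|u x IH] [|v y] b // syx.
have E := IH y (next_swap b u v x y) syx.
rewrite swaps_cons [lt_neq_count _ _]/= -/(lt_neq_count _ _) E [RHS]/= -/(lt_neq_count _ _).
congr (_ + _); case: x y {IH E} syx => [|u' x] [|v' y] //.
- by rewrite swaps_nil; case: b; rewrite /= // eq_sym; lia.
- by rewrite swaps_nil; case: b; rewrite /= // eq_sym; lia.
move: (next_swap _ _ _ _ _) => b' _.
by rewrite swaps_cons; case: b; case: b'; rewrite /= // 1?(eq_sym v u); lia.
Qed.

Lemma inv2_cons u x v y :
  inv2 (u :: x) (v :: y) = (v < u) + inv_over (Some u) x y.
Proof. by rewrite /inv2 /= /Q /= andbT orbF. Qed.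

(** By [cyc_add] every triple is a sum of comparisons minus a descent of [x]; the added descents
    compensate and complete the sum to one symmetric in each row. The bound [(size y).+1] accounts
    for the descent of [x] inside the last queue triple. *)
Lemma inv2_quinv2 x y : size y <= size x ->
  inv2 x y + quinv2 x y + (desc (size y).+1 x).*2 + desc (size y) x + desc (size y) y
  = lt_neq_count x y.
Proof.
suff H u x' v y' : size y' <= size x' -> 
  (v < u) + inv_over (Some u) x' y' + quinv2 (u :: x') (v :: y') +
  (desc (size y').+2 (u :: x')).*2 + desc (size y').+1 (u :: x') + desc (size y').+1 (v :: y')
  = lt_neq_count (u :: x') (v :: y').
  case: x y => [|u x] [|v y] //; first by rewrite !desc1.
    by rewrite !desc1 // /inv2 inv_over_nil.
  by rewrite inv2_cons; apply: (H u x v y).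
elim: x' u v y' => [|u' x' IH] u v [|v' y'] //.
- rewrite !desc_cons ![desc 1 _]desc1 //= => _.
  have := cyc_add 0 u v; rewrite neq_ltn; case: (ltngtP u v) => //=; lia.
- rewrite !desc_cons ![desc 1 _]desc1 //= => _.
  have := cyc_add u' u v; rewrite neq_ltn; case: (ltngtP u v) => //=; lia.
rewrite [size _ <= _]ltnS => /(IH u' v') {}IH.
rewrite [size (_ :: _)]/= !desc_cons inv_over_cons quinv2_cons.
rewrite [lt_neq_count _ _]/= -/(lt_neq_count (u' :: x') (v' :: y')) -IH.
have := cyc_add u' u v; have := cyc_add u' u v'.
have -> : (u != v) = (u < v) + (v < u) :> nat by rewrite neq_ltn; case: (ltngtP u v).
rewrite [desc (size y').+2 (u' :: x')]desc_cons /head.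
lia.
Qed.

Lemma nth_swaps_above b x y r : size y <= r ->
  nth 0 (swaps b x y).1 r = nth 0 x r.
Proof.
elim: x y b r => [|u x IH] [|v y] b [|r] //.
by rewrite swaps_cons [size _ <= _]ltnS => /IH E; apply: E.
Qed.

(** Crossing is unaffected by exchanges, and an exchange toggles both deciding triples of a block or
    neither, so each block receives the same decision again. *)
Lemma next_swap_swaps b u v x y : size y <= size x ->
  next_swap b (if b then v else u) (if b then u else v)
    (swaps (next_swap b u v x y) x y).1 (swaps (next_swap b u v x y) x y).2
  = next_swap b u v x y.
Proof.
case: x y => [|u' x] [|v' y] //.
rewrite [size _ <= _]ltnS => syx.
have C := @next_swap_cross b u v (u' :: x) v' y.
have E := top_quinv_swaps (next_swap b u v (u' :: x) (v' :: y)) u' v' syx.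
have F : ~~ cross u v u' v' -> next_swap b u v (u' :: x) (v' :: y) =
    (cyc u' u v' != top_quinv (u' :: x) (v' :: y)) by rewrite /next_swap /head => /negbTE ->.
move: E C F; move: (next_swap _ _ _ _ _) => b' E C F.
have S := swaps_cons b' u' x v' y.
rewrite [RHS](_ : b' = if cross u v u' v' then b else b'); last first.
  by case: ifP => // /C.
have [h1 h2] : head 0 (swaps b' (u' :: x) (v' :: y)).1 = (if b' then v' else u')
  /\ (swaps b' (u' :: x) (v' :: y)).2
     = (if b' then u' else v') :: behead (swaps b' (u' :: x) (v' :: y)).2.
  by rewrite S.
rewrite {1}h2 /next_swap h1 -h2 cross_if.
have [cr|ncr] := boolP (cross u v u' v'); first by [].
rewrite uncross_cycl_if; last by case: (b'); rewrite // crossCr.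
rewrite E cyc_ifl [RHS]F //.
by case: (b' && _); case: (cyc _ _ _); case: (top_quinv _ _).
Qed.

Lemma swaps_invol b x y : size y <= size x ->
  swaps b (swaps b x y).1 (swaps b x y).2 = (x, y).
Proof.
elim: x y b => [|u x IH] [|v y] b // syx.
rewrite swaps_cons swaps_cons next_swap_swaps // IH //.
by case: b.
Qed.

(* A sum over pairs of cells, one in each column: this is what makes the
   contributions with a third column depend on the row contents only. *)
Fixpoint linear2 (c d : seq nat) : nat :=
  match c, d with
  | u :: c', v :: d' =>
    (v < u) + (if d' is v' :: _ then u < v' : nat else 0) + linear2 c' d'
  | _, _ => 0
  end.

Lemma linear2_swaps_r z b x y : size y <= size x ->
  linear2 z (swaps b x y).1 + linear2 z (swaps b x y).2 = linear2 z x + linear2 z y.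
Proof.
elim: x y b z => [|u x IH] [|v y] b [|w z] // syx.
rewrite swaps_cons [LHS]/= [RHS]/= -!/(linear2 _ _) addnACA IH // [RHS]addnACA.
congr (_ + _); case: x y {IH} syx => [|u' x] [|v' y] //; rewrite ?swaps_nil.
- by case: b; rewrite /=; lia.
- by case: b; rewrite /=; lia.
move: (next_swap _ _ _ _ _) => b' _.
by rewrite swaps_cons; case: b; case: b'; rewrite /= //; lia.
Qed.

Lemma linear2_swaps_l z b x y : size y <= size x ->
  linear2 (swaps b x y).1 z + linear2 (swaps b x y).2 z = linear2 x z + linear2 y z.
Proof.
elim: x y b z => [|u x IH] [|v y] b [|w z] // syx; first by case: b.
rewrite swaps_cons [LHS]/= [RHS]/= -!/(linear2 _ _) addnACA IH // [RHS]addnACA.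
by congr (_ + _); case: b => //; rewrite addnC.
Qed.

(** Summing [cyc_add] over the rows: descents of the left column are the only nonlinear part of
    inv. *)
Lemma inv2_linear2 x y : size y <= size x ->
  inv2 x y + desc (size y) x = linear2 x y.
Proof.
case: x y => [|u x] [|v y] //; first by rewrite desc1.
  by rewrite desc1 // /inv2 inv_over_nil.
elim: x u v y => [|u' x IH] u v [|v' y] //; try by rewrite inv2_cons inv_over_nil desc1.
rewrite [size _ <= _]ltnS => /(IH u' v') {}IH.
rewrite [linear2 _ _]/= -/(linear2 (u' :: x) (v' :: y)) -IH !inv2_cons inv_over_cons.
rewrite [size (_ :: _)]/= [size (_ :: _)]/= desc_cons /head.
have := cyc_add u' u v'; lia.
Qed.

(** The same linear function governs quinv with the two columns reversed, which is what mirroring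
    exploits. *)
Lemma quinv2_linear2 x y : size y <= size x ->
  quinv2 x y + desc (size y).+1 x = linear2 y x.
Proof.
case: x y => [|u x] [|v y] //; first by rewrite desc1.
  by rewrite desc1.
elim: x u v y => [|u' x IH] u v [|v' y] //.
- move=> _; rewrite desc_cons desc1 //=; have := cyc_add 0 u v; lia.
- move=> _; rewrite desc_cons desc1 //=; have := cyc_add u' u v; case: x IH; lia.
rewrite [size _ <= _]ltnS => /(IH u' v') {}IH.
rewrite [linear2 _ _]/= -/(linear2 (v' :: y) (u' :: x)) -IH quinv2_cons.
rewrite [size (_ :: _)]/= [size (_ :: _)]/= desc_cons /head.
have := cyc_add u' u v; lia.
Qed.

Definition row_of (cs : seq (seq nat)) (r : nat) : seq nat :=
  [seq nth 0 c r | c <- cs & r < size c].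

Lemma row_of_swaps b x y r :  size y <= size x ->
  perm_eq (row_of [:: (swaps b x y).2; (swaps b x y).1] r) (row_of [:: x; y] r).
Proof.
elim: x y b r => [|u x IH] [|v y] b r // syx.
rewrite swaps_cons; case: r => [|r]; last first.
  have := IH y (next_swap b u v x y) r syx.
  by rewrite /row_of /= !ltnS !size_swaps; case: ifP; case: ifP.
by rewrite /row_of /=; case: b => //; apply/permP => a; rewrite /= addnCA.
Qed.

Definition exch (x y : seq nat) : seq nat * seq nat :=
  swaps ((head 0 y < head 0 x) != top_quinv x y) x y.

(** With infinity below, the inversion triple in row 1 is [v < u], so the lowest block obeys the
    same rule as the others: its bottom inversion triple and top queue triple are traded. *)
Lemma exch_first u x v y (T := top_quinv (u :: x) (v :: y)) (b := (v < u) != T) :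
  (((if b then u else v) < (if b then v else u)) = T)
  * ((b && (u != v)) (+) T = (v < u)).
Proof.
have : u = v -> T = false by rewrite /T => ->; apply: top_quinv_refl.
rewrite {}/b; move: T => t ut; case: (ltngtP u v) ut => [uv _|vu _|-> ->] //.
- by case: t; split => //=; lia.
- by case: t; split => //=; lia.
- by split => //=; lia.
Qed.

(** * Invariants of the exchange *)

Section Exchange.

Variables x y : seq nat.
Hypothesis syx : size y <= size x.

Lemma size_exch : (size (exch x y).1 = size x) * (size (exch x y).2 = size y).
Proof. by rewrite !size_swaps. Qed.

Lemma exch_invol : exch (exch x y).1 (exch x y).2 = (x, y).
Proof.
rewrite -[RHS](swaps_invol ((head 0 y < head 0 x) != top_quinv x y) syx).
rewrite {1}/exch -/(exch x y); congr (swaps _ _ _).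
case: x y syx => [|u x'] [|v y'] // s.
rewrite /exch top_quinv_swaps // swaps_cons [head _ _]/= [head _ (_ :: _)]/= [head _ (u :: _)]/=.
by rewrite !exch_first eq_sym.
Qed.

Lemma inv2_exch : inv2 (exch x y).1 (exch x y).2 = quinv2 x y.
Proof.
case: x y syx => [|u x'] [|v y'] // s.
rewrite /exch /head swaps_cons inv2_cons exch_first addnC.
exact: inv_over_swaps.
Qed.

Lemma quinv2_exch : quinv2 (exch x y).1 (exch x y).2 = inv2 x y.
Proof.
case: x y syx => [|u x'] [|v y'] // s.
by rewrite /exch quinv2_swaps // /head exch_first inv2_cons addnC.
Qed.

Lemma desc_exch_le k : k <= size y ->
  desc k (exch x y).1 + desc k (exch x y).2 = desc k x + desc k y.
Proof. exact: desc_swaps. Qed.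

(* By inv2_quinv2, twice this number is determined by inv + quinv and quantities
   that exchanges preserve. *)
Lemma desc_exch_gt k : size y < k -> desc k (exch x y).1 = desc k x.
Proof.
elim: k => // -[|k] IH; rewrite ltnS ?leqn0.
  by rewrite !desc1.
(* Only [size y + 1] needs an argument, because the entries of [x] above [y] are untouched. *)
rewrite leq_eqVlt => /orP[/eqP <-|sk]; last first.
  by rewrite !descS IH // !nth_swaps_above // -ltnS // ltnW.
have := @inv2_quinv2 (exch x y).1 (exch x y).2.
rewrite !size_exch lt_neq_count_swaps // -inv2_quinv2 // inv2_exch quinv2_exch.
have := desc_exch_le (leqnn _).
by rewrite -!addnA => -> /(_ syx); lia.
Qed.

Lemma linear2_exch_r z :
  linear2 z (exch x y).1 + linear2 z (exch x y).2 = linear2 z x + linear2 z y.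
Proof. exact: linear2_swaps_r. Qed.

Lemma linear2_exch_l z :
  linear2 (exch x y).1 z + linear2 (exch x y).2 z = linear2 x z + linear2 y z.
Proof. exact: linear2_swaps_l. Qed.

Lemma row_of_exch r :
  perm_eq (row_of [:: (exch x y).2; (exch x y).1] r) (row_of [:: x; y] r).
Proof. exact: row_of_swaps. Qed.

End Exchange.

Lemma desc_above k c : size c <= k -> desc k.+1 c = desc (size c) c.
Proof.
elim: k => [|k IH]; first by rewrite leqn0 => /eqP ->; rewrite !desc1.
move=> sk; rewrite descS [nth 0 c k.+1]nth_default // addn0.
by move: sk; rewrite leq_eqVlt => /orP[/eqP ->|/IH].
Qed.

(** * Sorting the columns *)

Fixpoint pair_sum (f : seq nat -> seq nat -> nat) (cs : seq (seq nat)) : nat :=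
  if cs is c :: cs' then \sum_(d <- cs') f c d + pair_sum f cs' else 0.

Lemma pair_sum_rcons f cs c :
  pair_sum f (rcons cs c) = pair_sum f cs + \sum_(d <- cs) f d c.
Proof.
elim: cs => [|d cs IH] /=; first by rewrite !big_nil.
by rewrite IH big_cons -cats1 big_cat big_seq1 /=; lia.
Qed.

Lemma pair_sum_rev f cs : pair_sum f (rev cs) = pair_sum (fun c d => f d c) cs.
Proof.
elim: cs => //= c cs IH.
by rewrite rev_cons pair_sum_rcons IH addnC (perm_big cs) ?perm_rev.
Qed.

Lemma eq_pair_sum (P : rel (seq nat)) f g cs :
  pairwise P cs -> (forall c d, P c d -> f c d = g c d) ->
  pair_sum f cs = pair_sum g cs.
Proof.
move=> + fg; elim: cs => //= c cs IH /andP[/allP Pc /IH ->].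
by congr (_ + _); apply: eq_big_seq => d /Pc /fg.
Qed.

Lemma pair_sumD f g cs :
  pair_sum (fun c d => f c d + g c d) cs = pair_sum f cs + pair_sum g cs.
Proof. by elim: cs => //= c cs ->; rewrite big_split addnACA. Qed.

(** Insertion sort whose elementary move is [exch]. With [ltn] it moves short columns to the left;
    with [eq_op] it carries [x] through its whole group of equal heights, so that sorting reverses
    the group. *)
Fixpoint insert_exch (lt : rel nat) (x : seq nat) (l : seq (seq nat)) :=
  if l is y :: l' then
    if lt (size y) (size x) then (exch x y).2 :: insert_exch lt (exch x y).1 l'
    else x :: l
  else [:: x].

Definition sort_exch (lt : rel nat) : seq (seq nat) -> seq (seq nat) :=
  foldr (insert_exch lt) [::].

Section Sort.

Variable lt : rel nat.
Hypothesis lt_le : forall a b, lt a b -> a <= b.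

Definition exch_add (g : seq nat -> nat) :=
  forall x y, lt (size y) (size x) -> g (exch x y).1 + g (exch x y).2 = g x + g y.

Lemma sum_insert g x l : exch_add g ->
  \sum_(c <- insert_exch lt x l) g c = \sum_(c <- x :: l) g c.
Proof.
move=> gP; elim: l x => //= y l IH x; case: ifP => // /gP yx.
by rewrite !big_cons IH !big_cons addnA [_ + g (exch x y).1]addnC yx addnA.
Qed.

Lemma sum_sort g l : exch_add g ->
  \sum_(c <- sort_exch lt l) g c = \sum_(c <- l) g c.
Proof.
by move=> gP; elim: l => //= c l IH; rewrite sum_insert // !big_cons IH.
Qed.

(** Third columns on the left, third columns on the right, and the exchanged pair itself in its new
    order. *)
Definition exch_stable (f : seq nat -> seq nat -> nat) :=
  [/\ forall z, exch_add (f z), forall z, exch_add (f^~ z)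
    & forall x y, lt (size y) (size x) -> f (exch x y).2 (exch x y).1 = f x y].

Lemma pair_sum_insert f x l : exch_stable f ->
  pair_sum f (insert_exch lt x l) = pair_sum f (x :: l).
Proof.
case=> fr fl fE; elim: l x => //= y l IH x; case: ifP => // yx.
rewrite /= sum_insert // IH /= !big_cons fE // -!addnA; congr (_ + _).
rewrite !addnA -!big_split; congr (_ + _); apply: eq_bigr => z _.
by rewrite /= addnC; apply: fl.
Qed.

Lemma pair_sum_sort f l : exch_stable f -> pair_sum f (sort_exch lt l) = pair_sum f l.
Proof.
move=> fP; elim: l => //= c l IH; rewrite pair_sum_insert //= IH sum_sort //.
by case: fP.
Qed.

Lemma row_of_cat cs ds r : row_of (cs ++ ds) r = row_of cs r ++ row_of ds r.
Proof. by rewrite /row_of filter_cat map_cat. Qed.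

Lemma row_of_insert x l r :
  perm_eq (row_of (insert_exch lt x l) r) (row_of (x :: l) r).
Proof.
elim: l x => //= y l IH x; case: ifP => // /lt_le yx.
rewrite -[(exch x y).2 :: _]cat1s row_of_cat.
have /permPl -> : perm_eq (row_of [:: (exch x y).2] r ++ row_of (insert_exch lt (exch x y).1 l) r)
   (row_of [:: (exch x y).2] r ++ row_of ((exch x y).1 :: l) r) by rewrite perm_cat2l.
by rewrite -row_of_cat /= -[_ :: _ :: l]/([:: _; _] ++ l) -[x :: _ :: l]/([:: _; _] ++ l)
  !row_of_cat perm_cat2r row_of_exch.
Qed.

Lemma row_of_sort l r : perm_eq (row_of (sort_exch lt l) r) (row_of l r).
Proof.
elim: l => //= c l IH; apply: perm_trans (row_of_insert _ _ _) _.
by rewrite -cat1s -[c :: l]cat1s !row_of_cat perm_cat2l.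
Qed.

Lemma size_insert x x' l l' : map size (x :: l) = map size (x' :: l') ->
  map size (insert_exch lt x l) = map size (insert_exch lt x' l').
Proof.
elim: l l' x x' => [|y l IH] [|y' l'] x x' //= [ex ey el].
rewrite -ex -ey; case: ifP => yx /=; last by rewrite ex ey el.
rewrite !size_exch -?ex -?ey ?lt_le // ey; congr (_ :: _); apply: IH => /=.
by rewrite !size_exch -?ex -?ey ?lt_le // el.
Qed.

Lemma size_sort l l' : map size l = map size l' ->
  map size (sort_exch lt l) = map size (sort_exch lt l').
Proof.
elim: l l' => [|c l IH] [|c' l'] //= [ec /IH el].
by apply: size_insert => /=; rewrite ec el.
Qed.

(** Equal heights make both insertions exchange at the same places, and [exch_invol] undoes each
    exchange. *)
Lemma insert_inj x x' l l' : map size (x :: l) = map size (x' :: l') ->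
  insert_exch lt x l = insert_exch lt x' l' -> x = x' /\ l = l'.
Proof.
elim: l l' x x' => [|y l IH] [|y' l'] x x' //=; first by move=> _ [->].
case=> ex ey el.
rewrite -ex -ey; case: ifP => yx; last by case=> -> -> ->.
have yx' : lt (size y') (size x') by rewrite -ex -ey.
case=> e2 /IH[|e1 ->] /=.
  by rewrite !size_exch ?lt_le // ex el.
have := exch_invol (lt_le yx); rewrite e1 e2 exch_invol ?lt_le // => -[-> ->].
by [].
Qed.

Lemma sort_inj l l' : map size l = map size l' ->
  sort_exch lt l = sort_exch lt l' -> l = l'.
Proof.
elim: l l' => [|c l IH] [|c' l'] //= [ec el].
case/insert_inj => [|-> /(IH _ el) -> //].
by rewrite /= ec (size_sort el).
Qed.

End Sort.

(* A descent in row r + 1 is counted once for each k > r up to the height, that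
   is leg + 1 times. *)
Definition col_maj (c : seq nat) : nat := \sum_(k < (size c).+1) desc k c.

(** Terms with [k <= size y] are preserved as a sum over both columns; the others concern the taller
    column alone, where [desc_exch_gt] applies. *)
Lemma col_maj_exch (lt : rel nat) : (forall a b, lt a b -> a <= b) -> exch_add lt col_maj.
Proof.
move=> lt_le x y /lt_le syx; rewrite /col_maj !size_exch //.
have split_sum c : \sum_(k < (size x).+1) desc k c =
    \sum_(0 <= k < (size y).+1) desc k c + \sum_((size y).+1 <= k < (size x).+1) desc k c.
  by rewrite -(big_mkord predT (fun k => desc k c)) -big_cat_nat.
rewrite !split_sum -!(big_mkord predT (fun k => desc k _)) addnAC -big_split.
rewrite [RHS]addnAC -big_split; congr (_ + _); apply: eq_big_nat => k /andP[sk ks].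
  exact: desc_exch_le.
exact: desc_exch_gt.
Qed.

(** One row above the common top, [desc_exch_gt] applies and the padding adds no descent. So the
    descent number travels with the moving column. *)
Lemma desc_exch_eq x y : size y = size x ->
  (desc (size x) (exch x y).1 = desc (size x) x)
  * (desc (size x) (exch x y).2 = desc (size x) y).
Proof.
move=> e; have syx : size y <= size x by rewrite e.
have E1 : desc (size x) (exch x y).1 = desc (size x) x.
  have := desc_exch_gt syx (leqnn (size y).+1).
  by rewrite e desc_above ?size_exch // desc_above.
have := desc_exch_le syx (leqnn (size y)); rewrite e E1 => /addnI E2.
by [].
Qed.

(** * Linear parts and descent corrections *)

Definition desc_short (c d : seq nat) : nat :=
  if size d <= size c then desc (size d) c else desc (size c).+1 d.

Lemma desc_short_exch_r z : exch_add leq (desc_short z).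
Proof.
move=> x y syx; rewrite /desc_short !size_exch //.
have [xz|zx] := leqP (size x) (size z); first by rewrite (leq_trans syx xz).
have [yz|zy] := leqP (size y) (size z); first by rewrite desc_exch_gt.
exact: desc_exch_le.
Qed.

Lemma desc_short_exch_l z : exch_add leq (desc_short^~ z).
Proof.
move=> x y syx; rewrite /desc_short !size_exch //.
have [zx|xz] := leqP (size z) (size x); last by rewrite leqNgt (leq_ltn_trans syx xz).
have [zy|yz] := leqP (size z) (size y); first exact: desc_exch_le.
by rewrite desc_exch_gt.
Qed.

(** The exchange trades inv and quinv and fixes the descent numbers, so it trades the two linear
    parts. *)
Lemma linear2_exch_eq x y : size y = size x ->
  (linear2 (exch x y).2 (exch x y).1 = linear2 x y)
  * (linear2 (exch x y).1 (exch x y).2 = linear2 y x).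
Proof.
move=> e; have syx : size y <= size x by rewrite e.
have sXY : size (exch x y).2 <= size (exch x y).1 by rewrite !size_exch.
rewrite -(quinv2_linear2 sXY) -(inv2_linear2 sXY) -(inv2_linear2 syx) -(quinv2_linear2 syx).
rewrite !size_exch // inv2_exch // quinv2_exch // e.
by rewrite !desc_above ?size_exch // !desc_exch_eq.
Qed.

Lemma linear2_exch_stable :
  exch_stable eq_op linear2 /\ exch_stable eq_op (fun c d => linear2 d c).
Proof.
split; split=> [z x y /eqP e|z x y /eqP e|x y /eqP e];
  rewrite ?linear2_exch_r ?linear2_exch_l ?linear2_exch_eq //; by rewrite e.
Qed.

(* The contribution of a column [c] to the left of [d], mirrored when [c] is the
   shorter one. *)
Definition inv_or_quinv2 (c d : seq nat) : nat :=
  if size d <= size c then inv2 c d else quinv2 d c.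

Lemma inv_or_quinv2_linear2 c d : inv_or_quinv2 c d + desc_short c d = linear2 c d.
Proof.
rewrite /inv_or_quinv2 /desc_short; have [dc|cd] := leqP; first exact: inv2_linear2.
by apply: quinv2_linear2; apply: ltnW.
Qed.

(** The linear part and its correction [desc_short] are both additive under exchanges, hence so is
    their difference. *)
Lemma inv_or_quinv2_exch_r z : exch_add leq (inv_or_quinv2 z).
Proof.
move=> x y syx; apply: (@addIn (desc_short z x + desc_short z y)).
by rewrite -{1}desc_short_exch_r // addnACA [RHS]addnACA !inv_or_quinv2_linear2 linear2_exch_r.
Qed.

Lemma inv_or_quinv2_exch_l z : exch_add leq (inv_or_quinv2^~ z).
Proof.
move=> x y syx; apply: (@addIn (desc_short x z + desc_short y z)).
by rewrite -{1}(desc_short_exch_l z) // addnACA [RHS]addnACA !inv_or_quinv2_linear2 linear2_exch_l.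
Qed.

Lemma inv_or_quinv2_exch_stable : exch_stable ltn inv_or_quinv2.
Proof.
split=> [z x y yx|z x y yx|x y /= yx]; first by apply: inv_or_quinv2_exch_r; apply: ltnW.
  by apply: inv_or_quinv2_exch_l; apply: ltnW.
by rewrite /inv_or_quinv2 !size_exch ?(ltnW yx) // leqNgt yx quinv2_exch // ltnW.
Qed.

(** At equal heights only the linear part of inv is kept, since that is what exchanges preserve; the
    descents are accounted for separately. *)
Definition inv_or_quinv2_lin (c d : seq nat) : nat :=
  if size c == size d then linear2 c d else inv_or_quinv2 c d.

Lemma inv_or_quinv2_lin_exch_stable : exch_stable eq_op inv_or_quinv2_lin.
Proof.
split=> [z x y /eqP e|z x y /eqP e|x y /eqP e]; have syx : size y <= size x by rewrite e.
- rewrite /inv_or_quinv2_lin !size_exch // e; case: ifP => _; first exact: linear2_exch_r.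
  exact: inv_or_quinv2_exch_r.
- rewrite /inv_or_quinv2_lin !size_exch // e; case: ifP => _; first exact: linear2_exch_l.
  exact: inv_or_quinv2_exch_l.
by rewrite /inv_or_quinv2_lin !size_exch // e eqxx linear2_exch_eq.
Qed.

(** At equal heights [desc_left] separates [linear2 c d] from [inv2 c d], and [desc_right] separates
    it from the mirrored [quinv2 d c]. *)
Definition desc_left (c d : seq nat) : nat := (size c == size d) * desc (size c) c.
Definition desc_right (c d : seq nat) : nat := (size c == size d) * desc (size d) d.

Lemma sum_desc_right_exch k :
  exch_add eq_op (fun d => (k == size d) * desc (size d) d).
Proof.
move=> x y /eqP e; have syx : size y <= size x by rewrite e.
by rewrite !size_exch // e -!mulnDr !desc_exch_eq.
Qed.

(** The descent number of [x] travels to the right end of its group and is counted there once per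
    other member; the remaining numbers keep their order. *)
Lemma insert_desc_right x l : sorted leq (map size (x :: l)) ->
  pair_sum desc_right (insert_exch eq_op x l)
  = pair_sum desc_right l + count_mem (size x) (map size l) * desc (size x) x.
Proof.
elim: l x => [|y l IH] x /=; first by rewrite big_nil.
case/andP=> xy yl; have [e|ne] := eqVneq.
  have syx : size y <= size x by rewrite e.
  rewrite /= (sum_insert _ _ (sum_desc_right_exch _)) /=.
  rewrite IH /= ?size_exch // ?desc_exch_eq //; last by rewrite -e.
  rewrite big_cons !size_exch // !desc_exch_eq // e eqxx mul1n.
  under [in RHS]eq_bigr do rewrite /desc_right e.
  rewrite mulnDl mul1n; lia.
have gt d : d \in y :: l -> size x != size d.
  rewrite in_cons => /orP[/eqP -> |dl]; first by rewrite eq_sym.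
  have /allP/(_ _ (map_f size dl)) yd := order_path_min leq_trans yl.
  by apply: contraNneq ne => e; rewrite e in xy *; rewrite eqn_leq xy yd.
rewrite [count_mem _ _](_ : _ = 0) ?mul0n ?addn0; last first.
  by apply/count_memPn/mapP => -[d dl]; apply/eqP/gt; rewrite in_cons dl orbT.
rewrite /= [\sum_(d <- y :: l) _]big1_seq //= => d /gt.
by rewrite /desc_right => /negbTE ->.
Qed.

Lemma sort_desc_right l : sorted leq (map size l) ->
  pair_sum desc_right (sort_exch eq_op l) = pair_sum desc_left l.
Proof.
have eq_le (a b : nat) : a == b -> a <= b by move/eqP->.
have sz x l' : map size (insert_exch eq_op x l') = map size (x :: l').
  elim: l' x => //= y l' IH x; case: ifP => //= /eqP e.
  by rewrite IH /= !size_exch ?e.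
have szs l' : map size (sort_exch eq_op l') = map size l'.
  by elim: l' => //= c l' IH; rewrite sz /= IH.
elim: l => //= c l IH cl; rewrite insert_desc_right; last by rewrite map_cons szs.
rewrite IH ?(path_sorted cl) //.
rewrite addnC szs; congr (_ + _).
rewrite /desc_left -big_distrl /= -sum1_count big_map big_mkcond /=.
by congr (_ * _); apply: eq_bigr => d _; rewrite eq_sym; case: eqP.
Qed.

(** * The bijection on lists of columns *)

Definition exch_rev (cs : seq (seq nat)) : seq (seq nat) :=
  rev (sort_exch eq_op (sort_exch ltn cs)).

Lemma eqn_leqW (a b : nat) : a == b -> a <= b. Proof. by move/eqP->. Qed.
Lemma ltn_leqW (a b : nat) : a < b -> a <= b. Proof. exact: ltnW. Qed.

Lemma size_insert_eq x l : map size (insert_exch eq_op x l) = map size (x :: l).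
Proof.
elim: l x => //= y l IH x; case: ifP => //= /eqP e.
by rewrite IH /= !size_exch ?e.
Qed.

Lemma size_sort_eq l : map size (sort_exch eq_op l) = map size l.
Proof. by elim: l => //= c l IH; rewrite size_insert_eq /= IH. Qed.

Lemma size_insert_ltn x l :
  sorted leq (map size l) -> all (leq^~ (size x)) (map size l) ->
  map size (insert_exch ltn x l) = rcons (map size l) (size x).
Proof.
elim: l x => //= y l IH x yl /andP[yx lx]; case: ifP => [lt|/negbT].
  by rewrite /= IH ?size_exch // (path_sorted yl).
rewrite -leqNgt /= => xy.
(* Insertion stops at the first column not shorter than [x]; all heights from there on equal
   [size x], so stopping early gives the same list of heights. *)
have {xy yx} e : size y = size x by apply/eqP; rewrite eqn_leq xy yx.
have : all (pred1 (size x)) (map size l).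
  apply/allP => k kl /=; rewrite eqn_leq (allP lx) //= -e.
  exact: (allP (order_path_min leq_trans yl)).
move=> sl; rewrite e; congr (_ :: _).
by elim: (map size l) sl => //= k s IHs /andP[/eqP -> /IHs <-].
Qed.

Lemma size_sort_ltn l : sorted geq (map size l) ->
  map size (sort_exch ltn l) = rev (map size l).
Proof.
elim: l => //= c l IH cl; have sl := path_sorted cl.
have cle := order_path_min (rev_trans leq_trans) cl.
by rewrite size_insert_ltn ?IH ?rev_cons ?rev_sorted ?all_rev.
Qed.

Lemma size_exch_rev l : sorted geq (map size l) -> map size (exch_rev l) = map size l.
Proof. by move=> sl; rewrite map_rev size_sort_eq size_sort_ltn // revK. Qed.

Lemma sum_exch_rev l : \sum_(c <- exch_rev l) col_maj c = \sum_(c <- l) col_maj c.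
Proof.
rewrite (perm_big (sort_exch eq_op (sort_exch ltn l))) ?perm_rev //=.
rewrite sum_sort; last exact/col_maj_exch/eqn_leqW.
by rewrite sum_sort //; apply/col_maj_exch/ltn_leqW.
Qed.

Lemma row_of_exch_rev l r : perm_eq (row_of (exch_rev l) r) (row_of l r).
Proof.
apply: perm_trans (row_of_sort ltn_leqW l r).
apply: perm_trans (row_of_sort eqn_leqW _ r).
by rewrite /row_of /exch_rev filter_rev map_rev perm_rev.
Qed.

Lemma exch_rev_inj l l' : map size l = map size l' ->
  exch_rev l = exch_rev l' -> l = l'.
Proof.
move=> e /(can_inj revK) /(sort_inj eqn_leqW) E.
by apply: (sort_inj ltn_leqW e); apply: E; apply: size_sort => //; apply: ltn_leqW.
Qed.

Lemma pairwise_size (r : rel nat) (l : seq (seq nat)) : transitive r ->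
  sorted r (map size l) = pairwise (fun c d => r (size c) (size d)) l.
Proof. by move=> tr; rewrite sorted_pairwise // pairwise_map. Qed.

Lemma quinv2_exch_rev l : sorted geq (map size l) ->
  pair_sum quinv2 (exch_rev l) = pair_sum inv2 l.
Proof.
move=> sl; rewrite pair_sum_rev.
have -> : pair_sum inv2 l = pair_sum inv_or_quinv2 l.
  apply: (eq_pair_sum (P := fun c d => geq (size c) (size d))) => [|c d dc].
    by move: sl; rewrite (pairwise_size _ (rev_trans leq_trans)).
  by move: dc; rewrite /inv_or_quinv2 /= => ->.
rewrite -(pair_sum_sort _ inv_or_quinv2_exch_stable).
have := size_sort_ltn sl; move: (sort_exch _ _) => l1 sz.
have {sz sl} sl1 : sorted leq (map size l1) by rewrite sz rev_sorted.
(* The correction added is [desc_left] before the reversal of groups and [desc_right] after it; both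
   sides become pair sums of [inv_or_quinv2_lin]. *)
apply: (@addIn (pair_sum desc_left l1)).
rewrite -{1}(sort_desc_right sl1) -!pair_sumD.
rewrite [RHS](eq_pair_sum (P := fun _ _ => true) (g := inv_or_quinv2_lin)); last 2 first.
- by elim: (l1) => //= c l2 ->; rewrite all_predT.
- move=> c d _; rewrite /inv_or_quinv2_lin /desc_left; case: eqP => [e|_]; last exact: addn0.
  by rewrite -inv_or_quinv2_linear2 /inv_or_quinv2 /desc_short e leqnn mul1n.
rewrite -(pair_sum_sort _ inv_or_quinv2_lin_exch_stable).
apply: (eq_pair_sum (P := fun c d => leq (size c) (size d))) => [|c d cd].
  by move: sl1; rewrite -size_sort_eq (pairwise_size _ leq_trans).
rewrite /inv_or_quinv2_lin /desc_right /inv_or_quinv2; case: eqVneq => [e|ne].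
  by rewrite mul1n -quinv2_linear2 ?e // desc_above.
by rewrite addn0 leqNgt ltn_neqAle ne cd.
Qed.

Lemma sort_exch_const (n : nat) l : all (pred1 n) (map size l) -> sort_exch ltn l = l.
Proof.
elim: l => //= c l IH /andP[/eqP cn ln]; rewrite IH //.
by case: l ln {IH} => //= d l /andP[/eqP -> _]; rewrite cn ltnn.
Qed.

(** With one common height the first sort does nothing, and the reversal argument applies to
    [linear2] with its arguments exchanged. *)
Lemma inv2_exch_rev (n : nat) l : all (pred1 n) (map size l) ->
  pair_sum inv2 (exch_rev l) = pair_sum quinv2 l.
Proof.
move=> ln; rewrite pair_sum_rev (sort_exch_const ln).
have pw (l' : seq (seq nat)) : all (pred1 n) (map size l') ->
    pairwise (fun c d => (size c == n) && (size d == n)) l'.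
  elim: l' => //= c l' IH /andP[-> /[dup] /IH -> ]; rewrite andbT /=.
  by rewrite all_map.
have sl : sorted leq (map size l).
  rewrite (pairwise_size _ leq_trans); have := pw _ ln.
  by apply: sub_pairwise => c d /andP[/eqP -> /eqP ->].
apply: (@addIn (pair_sum desc_left l)).
rewrite -{1}(sort_desc_right sl) -!pair_sumD.
rewrite [RHS](eq_pair_sum (g := fun c d => linear2 d c) (pw _ ln)); last first.
  move=> c d /andP[/eqP c_n /eqP dn].
  by rewrite /desc_left c_n dn eqxx mul1n -quinv2_linear2 ?c_n ?dn // desc_above ?c_n.
rewrite -(pair_sum_sort _ (proj2 linear2_exch_stable)).
apply: (eq_pair_sum (pw _ _)) => [|c d /andP[/eqP c_n /eqP dn]].
  by rewrite size_sort_eq.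
by rewrite /desc_right c_n dn eqxx mul1n -inv2_linear2 ?c_n ?dn.
Qed.

(** * From fillings to columns *)

Lemma pair_sumE f cs : pair_sum f cs =
  \sum_(i < size cs) \sum_(j < size cs | i < j) f (nth [::] cs i) (nth [::] cs j).
Proof.
elim: cs => [|c cs IH] /=; first by rewrite big_ord0.
rewrite (big_nth [::]) big_mkord IH [RHS]big_ord_recl; congr (_ + _).
  by rewrite [RHS]big_mkcond big_ord_recl /= add0n.
by apply: eq_bigr => i _; rewrite [RHS]big_mkcond big_ord_recl /= add0n [LHS]big_mkcond.
Qed.

Lemma sum_triples (P : nat -> nat -> nat -> bool) m n :
  \sum_(0 <= r < m) \sum_(1 <= i < n.+1) \sum_(1 <= j < n.+1 | P r i j) 1
  = \sum_(i < n) \sum_(j < n) \sum_(r < m) P r i.+1 j.+1.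
Proof.
rewrite exchange_big big_add1 big_mkord; apply: eq_bigr => i _.
rewrite [RHS]exchange_big big_mkord; apply: eq_bigr => r _.
rewrite big_add1 big_mkord big_mkcond; apply: eq_bigr => j _.
by case: (P _ _ _).
Qed.

Lemma col_majE c :
  col_maj c = \sum_(r < size c) (nth 0 c r < nth 0 c r.+1) * (size c - r.+1).
Proof.
rewrite /col_maj; elim: (size c) => [|n IH]; first by rewrite big_ord_recl !big_ord0 desc1.
rewrite big_ord_recr IH /= /desc /= [RHS]big_ord_recr /= subnn muln0 addn0 -big_split.
by apply: eq_bigr => r _; rewrite /= -mulnSr; congr (_ * _); have := ltn_ord r; lia.
Qed.

Lemma quinv2E x y : size y <= size x -> 
  quinv2 x y = \sum_(r < size y) cyc (nth 0 x r.+1) (nth 0 x r) (nth 0 y r).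
Proof.
elim: x y => [|u x IH] [|v y] //; rewrite ?big_ord0 // => syx.
by rewrite quinv2_cons IH // big_ord_recl /= nth0.
Qed.

Lemma inv_overE b x y : size y <= size x ->
  inv_over b x y = \sum_(r < size y)
    Q (Some (nth 0 x r)) (if nat_of_ord r is r'.+1 then Some (nth 0 x r') else b)
      (Some (nth 0 y r)).
Proof.
elim: x y b => [|u x IH] [|v y] b //; rewrite ?big_ord0 // => syx.
rewrite [LHS]/= IH // [RHS]big_ord_recl; congr (_ + _).
by apply: eq_bigr => r _; case: r => -[|r] rP.
Qed.

(** * Transposition between rows and columns *)

Section Transpose.

Variable cs : seq (seq nat).
Hypothesis cs_sorted : sorted geq (map size cs).

(** With weakly decreasing heights the columns reaching row [r] form a prefix, so filtering shifts
    no position. *)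
Lemma nth_row_of r j :
  (nth 0 (row_of cs r) j = nth 0 (nth [::] cs j) r)
  * ((j < size (row_of cs r)) = (r < size (nth [::] cs j))).
Proof.
elim: cs j cs_sorted => [|c l IH] j /=; first by rewrite /row_of !nth_nil.
move=> cl; rewrite /row_of /=; case: ifP => rc.
  by case: j => [|j] //=; apply: IH; apply: path_sorted cl.
have small d : d \in c :: l -> size d <= r.
  rewrite in_cons => /orP[/eqP->|dl]; first by rewrite leqNgt rc.
  apply: leq_trans (_ : size c <= r); last by rewrite leqNgt rc.
  exact: (allP (order_path_min (rev_trans leq_trans) cl) _ (map_f size dl)).
rewrite (_ : filter _ l = [::]) /=; last first.
  apply/eqP; rewrite -size_eq0 size_filter -leqn0 leqNgt -has_count.
  apply/hasPn => d dl; rewrite -leqNgt small // in_cons dl orbT //.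
have sj : size (nth [::] (c :: l) j) <= r.
  have [jl|jl] := ltnP j (size (c :: l)); last by rewrite nth_default.
  exact/small/mem_nth.
by rewrite nth_nil nth_default // [r < _]ltnNge sj.
Qed.

Definition transp n := mkseq (row_of cs) n.

Lemma sorted_transp n : sorted geq (map size (transp n)).
Proof.
rewrite /transp /mkseq -map_comp; apply/(sortedP 0) => i; rewrite size_map size_iota => iP.
rewrite !(nth_map 0) ?size_iota ?(ltnW iP) // !nth_iota ?(ltnW iP) //=.
rewrite /row_of !size_map !size_filter.
by apply: sub_count => d /ltnW.
Qed.

End Transpose.

Lemma transpK cs n : sorted geq (map size cs) -> all (fun c => size c <= n) cs ->
  transp (transp cs n) (size cs) = cs.
Proof.
move=> cs_sorted /allP cn; rewrite -[RHS](mkseq_nth [::]) /transp.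
apply/eq_in_map => j; rewrite mem_iota add0n => /andP[_ jcs].
rewrite {1}/row_of /mkseq filter_map -map_comp.
rewrite (eq_filter (a2 := fun r => r < size (nth [::] cs j))); last first.
  by move=> r /=; rewrite nth_row_of.
have -> : [seq r <- iota 0 n | r < size (nth [::] cs j)] = iota 0 (size (nth [::] cs j)).
  by apply: (@filter_iota_ltn 0); apply/cn/mem_nth.
rewrite -[RHS](mkseq_nth 0); apply: eq_map => r /=.
by rewrite nth_row_of.
Qed.

Lemma row_ofE cs n r : r < n -> nth [::] (transp cs n) r = row_of cs r.
Proof. by move=> rn; rewrite nth_mkseq. Qed.

(** * Statistics of a filling as sums over its columns *)

Section Statistics.

Variables (mu : seq nat) (tau : seq (seq nat)).
Hypotheses (mu_part : is_partition mu) (tau_fill : is_filling mu tau).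

Let n := head 0 mu.
Let cs := transp tau n.
Let col := nth [::] cs.

Lemma shape_tau : map size tau = mu.
Proof. by case/andP: tau_fill => /eqP. Qed.

Lemma size_tau : size tau = size mu.
Proof. by rewrite -shape_tau size_map. Qed.

Lemma sorted_tau : sorted geq (map size tau).
Proof. by rewrite shape_tau; case/andP: mu_part. Qed.

Lemma size_cols : size cs = n. Proof. by rewrite size_mkseq. Qed.

Lemma entryE r j : j < n -> entry tau r.+1 j.+1 = nth 0 (col j) r.
Proof. by move=> jn; rewrite /entry /col row_ofE // nth_row_of // sorted_tau. Qed.

Lemma size_colE j : j < n -> size (col j) = col_height mu j.+1.
Proof.
by move=> jn; rewrite /col row_ofE // /row_of size_map size_filter /col_height -shape_tau count_map.
Qed.

Lemma size_col_le j : j < n -> size (col j) <= size mu.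
Proof. by move=> jn; rewrite size_colE // count_size. Qed.

Lemma size_col_anti i j : i <= j -> j < n -> size (col j) <= size (col i).
Proof.
move=> ij jn; rewrite !size_colE ?(leq_ltn_trans ij) //.
by apply: sub_count => k /(leq_ltn_trans _); apply.
Qed.

Lemma in_diagramE r j : j < n -> in_diagram mu r.+1 j.+1 = (r < size (col j)).
Proof.
move=> jn; rewrite /in_diagram /= /col row_ofE // nth_row_of ?sorted_tau //.
rewrite -shape_tau size_map; have [rt|rt] := ltnP r (size tau).
  by rewrite (nth_map [::]).
by rewrite [nth [::] tau r]nth_default.
Qed.

(** The default 0 of [nth] supplies the extra entry above a column. *)
Lemma ext_entryE r j : j < n -> r <= size (col j) ->
  ext_entry mu tau r.+1 j.+1 = Some (nth 0 (col j) r).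
Proof.
move=> jn rj; rewrite /ext_entry -size_colE //= eqSS entryE //.
by case: eqP => // ->; rewrite nth_default.
Qed.

Lemma in_ext_diagramE r j : j < n -> in_ext_diagram mu r j.+1 = (r <= (size (col j)).+1).
Proof. by move=> jn; rewrite /in_ext_diagram size_colE // -/n jn. Qed.

Lemma entry_neq0 r j : j < n -> r < size (col j) -> nth 0 (col j) r != 0.
Proof.
move=> jn; rewrite /col row_ofE // nth_row_of ?sorted_tau // => jr.
have rt : r < size tau by rewrite ltnNge; apply: contraL jr => rt; rewrite nth_default.
rewrite nth_row_of ?sorted_tau // -lt0n.
case/andP: tau_fill => _ /allP/(_ _ (mem_nth [::] rt))/allP; apply.
exact: mem_nth.
Qed.

Lemma sum_ltn_cond k m (F : nat -> nat) : k <= m ->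
  \sum_(r < m) (if r < k then F r else 0) = \sum_(r < k) F r.
Proof. by move=> km; rewrite (big_ord_widen m F km) [RHS]big_mkcond. Qed.

Lemma legE r j : j < n -> r < size (col j) -> leg mu r.+1 j.+1 + 1 = size (col j) - r.
Proof.
move=> jn rj; rewrite /leg big_add1 /=.
rewrite (eq_bigl (fun r' => r' < size (col j))) => [|r']; last exact: in_diagramE.
rewrite -(@big_nat_widen _ _ _ _ _ _ predT) ?size_col_le //.
by rewrite sum_nat_const_nat muln1 addn1 subnSK.
Qed.

Lemma filling_majE : filling_maj mu tau = \sum_(c <- cs) col_maj c.
Proof.
rewrite /filling_maj; under eq_bigr do rewrite big_mkcond.
rewrite exchange_big big_add1 big_mkord (big_nth [::]) big_mkord size_cols.
apply: eq_bigr => -[j jn] _; rewrite big_add1 big_mkord -/(col j) col_majE /=.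
(* The bottom row has no descent; a higher row is indexed by the row below it, as in [col_majE]. *)
pose g r := if r is r'.+1 then
  (nth 0 (col j) r' < nth 0 (col j) r'.+1) * (size (col j) - r'.+1) else 0.
rewrite (eq_bigr (fun r : 'I__ => if r < size (col j) then g r else 0)); last first.
  move=> [r rm] _; rewrite /= /is_descent in_diagramE //.
  case: ifP => [/and3P[rj r0 d]|].
    rewrite legE // rj; case: r r0 d {rm} rj => // r _ d rj.
    by move: d; rewrite /= !entryE // => ->; rewrite mul1n.
  case: ltnP => // rj; case: r rj {rm} => // r rj; rewrite /= !entryE //.
  by move=> /negbT; rewrite -leqNgt ltnNge => ->.
rewrite sum_ltn_cond ?size_col_le //.
case: (size (col j)) @g => [|k] g; first by rewrite !big_ord0.
by rewrite big_ord_recl [RHS]big_ord_recr /= subnn muln0 addn0.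
Qed.

Lemma filling_quinvE : filling_quinv mu tau = pair_sum quinv2 cs.
Proof.
rewrite /filling_quinv (sum_triples (quinv_triple mu tau)) pair_sumE size_cols.
apply: eq_bigr => -[i iP] _; rewrite [RHS]big_mkcond; apply: eq_bigr => -[j jP] _ /=.
case: ifP => ij; last first.
  by rewrite big1 // => r _; rewrite /quinv_triple ltnS ij !andbF.
have le_ji := size_col_anti (ltnW ij) jP.
(* In row 0 the second and third entries are both infinite, so there is no triple. *)
rewrite quinv2E // big_ord_recl [X in X + _](_ : _ = 0) ?add0n; last first.
  rewrite /quinv_triple /= [ext_entry _ _ 0 _]/= ext_entryE //.
  by rewrite /Q /= !andbF.
rewrite -(sum_ltn_cond (m := (size mu).+1) (fun r =>
  nat_of_bool (cyc (nth 0 (col i) r.+1) (nth 0 (col i) r) (nth 0 (col j) r))))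
  ?(leqW (size_col_le _)) //.
apply: eq_bigr => r _; rewrite lift0 /quinv_triple !in_ext_diagramE // !ltnS ij.
case: (ltnP r (size (col j))) => rj.
  rewrite !ext_entryE ?(leq_trans rj) ?(ltnW (leq_trans rj le_ji)) ?(ltnW rj) //.
  rewrite (inj_eq Some_inj) entry_neq0 // (leq_trans rj le_ji) (ltnW (leq_trans rj le_ji)) (ltnW rj).
(* At [r = size (col j)] the third entry is the extra 0, which is excluded; higher cells lie outside
   the extended diagram. *)
have [e|ne] := eqVneq (nat_of_ord r) (size (col j)); last first.
  have {}rj : size (col j) < r by rewrite ltn_neqAle eq_sym ne rj.
  by rewrite [r <= size (col j)]leqNgt rj !andbF.
by rewrite [ext_entry _ _ _ j.+1]ext_entryE // ?e // nth_default ?e // eqxx !andbF.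
Qed.

Lemma filling_invE : filling_inv mu tau = pair_sum inv2 cs.
Proof.
rewrite /filling_inv (sum_triples (inv_triple mu tau)) pair_sumE size_cols.
apply: eq_bigr => -[i iP] _; rewrite [RHS]big_mkcond; apply: eq_bigr => -[j jP] _ /=.
case: ifP => ij; last first.
  by rewrite big1 // => r _; rewrite /inv_triple ltnS ij !andbF.
have le_ji := size_col_anti (ltnW ij) jP.
rewrite /inv2 inv_overE // big_ord_recl add0n.
rewrite -(sum_ltn_cond (m := (size mu).+1) (fun r =>  nat_of_bool (Q (Some (nth 0 (col i) r))
   (if r is r'.+1 then Some (nth 0 (col i) r') else None)
     (Some (nth 0 (col j) r))))) ?(leqW (size_col_le _)) //.
apply: eq_bigr => r _; rewrite lift0 /inv_triple !in_ext_diagramE // !ltnS ij.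
case: (ltnP r (size (col j))) => rj.
  have ri := leq_trans rj le_ji.
  rewrite !ext_entryE ?(ltnW ri) ?(ltnW rj) //.
  rewrite (inj_eq Some_inj) entry_neq0 //= leqW ?(ltnW ri) //=.
  case: r {rj} ri => -[|r] //= _ ri.
  by rewrite ext_entryE // -ltnS ltnW // ltnW.
have [e|ne] := eqVneq (nat_of_ord r) (size (col j)); last first.
  have {}rj : size (col j) < r by rewrite ltn_neqAle eq_sym ne rj.
  by rewrite [r <= size (col j)]leqNgt rj !andbF.
by rewrite [ext_entry _ _ _ j.+1]ext_entryE // ?e // nth_default ?e // eqxx !andbF.
Qed.

End Statistics.

(** * The bijection on fillings *)

Definition exch_filling (mu : seq nat) (tau : seq (seq nat)) : seq (seq nat) :=
  transp (exch_rev (transp tau (head 0 mu))) (size mu).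

Section Filling.

Variables (mu : seq nat) (tau : seq (seq nat)).
Hypotheses (mu_part : is_partition mu) (tau_fill : is_filling mu tau).

Let cs := transp tau (head 0 mu).

Lemma size_exch_cols : map size (exch_rev cs) = map size cs.
Proof. exact/size_exch_rev/sorted_transp. Qed.

Lemma transp_filling : transp cs (size mu) = tau.
Proof.
rewrite -(size_tau tau_fill) transpK ?(sorted_tau mu_part tau_fill) //.
apply/allP => c /(map_f size).
rewrite (shape_tau tau_fill); case: (mu) mu_part => [|k s] //= /andP[/= sk _].
rewrite in_cons => /orP[/eqP -> //|].
exact: (allP (order_path_min (rev_trans leq_trans) sk)).
Qed.

Lemma transp_exch_filling : transp (exch_filling mu tau) (head 0 mu) = exch_rev cs.
Proof.
rewrite /exch_filling -/cs -(size_cols mu tau) -/cs -(size_map size cs).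
rewrite -size_exch_cols size_map transpK ?size_exch_cols ?sorted_transp //.
apply/allP => c /(map_f size); rewrite size_exch_cols => /mapP[d dcs ->].
move: dcs => /(nthP [::])[j]; rewrite size_cols => jn <-.
exact: size_col_le.
Qed.

Lemma row_exch_filling r :
  perm_eq (nth [::] tau r) (nth [::] (exch_filling mu tau) r).
Proof.
have [rm|rm] := ltnP r (size mu); last first.
  by rewrite !nth_default ?size_mkseq ?(size_tau tau_fill).
by rewrite -{1}transp_filling !row_ofE // perm_sym row_of_exch_rev.
Qed.

Lemma exch_filling_fill : is_filling mu (exch_filling mu tau).
Proof.
apply/andP; split.
  apply/eqP/(@eq_from_nth _ 0); first by rewrite size_map size_mkseq.
  move=> r; rewrite size_map size_mkseq => rm.
  rewrite (nth_map [::]) ?size_mkseq // -(perm_size (row_exch_filling r)).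
  by rewrite -[in RHS](shape_tau tau_fill) (nth_map [::]) // (size_tau tau_fill).
apply/(all_nthP [::]) => r rm; rewrite -(perm_all _ (row_exch_filling r)).
apply: (all_nthP [::] _) => //; first by case/andP: tau_fill.
by rewrite (size_tau tau_fill); rewrite size_mkseq in rm.
Qed.

Lemma filling_maj_exch : filling_maj mu (exch_filling mu tau) = filling_maj mu tau.
Proof.
rewrite !filling_majE ?exch_filling_fill // transp_exch_filling.
exact: sum_exch_rev.
Qed.

Lemma filling_quinv_exch : filling_quinv mu (exch_filling mu tau) = filling_inv mu tau.
Proof.
rewrite filling_quinvE ?exch_filling_fill // filling_invE // transp_exch_filling.
by rewrite quinv2_exch_rev // sorted_transp.
Qed.

Lemma filling_inv_exch m n : mu = nseq m n ->
  filling_inv mu (exch_filling mu tau) = filling_quinv mu tau.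
Proof.
move=> mu_rect; rewrite filling_invE ?exch_filling_fill // filling_quinvE // transp_exch_filling.
apply: (@inv2_exch_rev (size mu)); apply/allP => _ /mapP[c + ->].
move=> /(nthP [::])[j]; rewrite size_cols => jn <- /=.
rewrite size_colE // /col_height -all_count; move: jn.
by rewrite mu_rect; case: (m) => //= k jn; rewrite all_nseq jn orbT.
Qed.

End Filling.

Lemma exch_filling_inj mu tau tau' : is_partition mu ->
  is_filling mu tau -> is_filling mu tau' ->
  exch_filling mu tau = exch_filling mu tau' -> tau = tau'.
Proof.
move=> mu_part tf tf' e; rewrite -(transp_filling mu_part tf) -(transp_filling mu_part tf').
congr (transp _ _); apply: exch_rev_inj.
  rewrite /transp /mkseq -!map_comp; apply: eq_map => r /=.
  rewrite /row_of !size_map !size_filter -!(count_map size (fun k => r < k)).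
  by rewrite (shape_tau tf) (shape_tau tf').
by rewrite -!transp_exch_filling // e.
Qed.

Lemma row_equiv_exch mu sigma tau : is_partition mu -> is_filling mu tau ->
  row_equiv sigma tau -> row_equiv sigma (exch_filling mu tau).
Proof.
move=> mu_part tf.
have : size (exch_filling mu tau) = size tau by rewrite size_mkseq (size_tau tf).
have := row_exch_filling mu_part tf.
elim: sigma tau (exch_filling mu tau) {tf} => [|s sg IH] [|t ta] [|t' ta'] //=.
move=> perm_tt [sz] /andP[st sgt]; rewrite (perm_trans st (perm_tt 0)) /=.
by apply: IH sgt => // r; apply: (perm_tt r.+1).
Qed.

Lemma perm_row_class mu sigma : is_partition mu -> is_filling mu sigma ->
  perm_eq (map (exch_filling mu) (row_class sigma)) (row_class sigma).
Proof.
move=> mu_part sf.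
have fill tau : tau \in row_class sigma -> is_filling mu tau.
  by rewrite (mem_row_class _ sf) => /andP[].
have uniq_im : uniq (map (exch_filling mu) (row_class sigma)).
  rewrite map_inj_in_uniq ?row_class_uniq // => tau tau' /fill tf /fill tf'.
  exact: exch_filling_inj.
apply: uniq_perm; rewrite ?row_class_uniq //.
(* An injective map of the finite class into itself is onto, by comparing sizes. *)
apply: (uniq_min_size uniq_im _ _).2; last by rewrite size_map.
move=> _ /mapP[tau tc ->]; rewrite (mem_row_class _ sf) exch_filling_fill ?fill //=.
by apply: row_equiv_exch; rewrite ?fill //; move: tc; rewrite (mem_row_class _ sf) => /andP[].
Qed.

(** * The generating function identities *)

Import GRing.Theory.
Local Open Scope ring_scope.

Theorem theorem1p1 (mu : seq nat) (sigma : seq (seq nat))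
    (mu_part : is_partition mu) (sigma_fill : is_filling mu sigma) :
  (\sum_(tau <- row_class sigma) tvar ^+ filling_maj mu tau * qvar ^+ filling_inv mu tau
     = \sum_(tau <- row_class sigma) tvar ^+ filling_maj mu tau * qvar ^+ filling_quinv mu tau)
  /\
  (forall m n : nat, (1 <= m)%N -> (1 <= n)%N -> mu = nseq m n ->
     \sum_(tau <- row_class sigma)
        tvar ^+ filling_maj mu tau * qvar ^+ filling_inv mu tau * uvar ^+ filling_quinv mu tau
     = \sum_(tau <- row_class sigma)
        tvar ^+ filling_maj mu tau * uvar ^+ filling_inv mu tau * qvar ^+ filling_quinv mu tau).
Proof.
have fill tau : tau \in row_class sigma -> is_filling mu tau.
  by rewrite (mem_row_class _ sigma_fill) => /andP[].
have reindex := perm_big _ (perm_row_class mu_part sigma_fill).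
split=> [|m n _ _ mu_rect]; rewrite -[RHS]reindex big_map; apply: eq_big_seq => tau /fill tf.
  by rewrite filling_maj_exch // filling_quinv_exch.
rewrite filling_maj_exch // filling_quinv_exch // (filling_inv_exch mu_part tf mu_rect).
by rewrite -!mulrA [uvar ^+ _ * _]mulrC.
Qed.
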